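(* Let $D=xy\frac{\partial}{\partial x}+x^2\frac{\partial}{\partial y}$ be the derivation on Laurent polynomials in $x,y$ with $D(x)=xy$, $D(y)=x^2$, and for a Laurent polynomial $f$ let $\mathrm{Gen}(f,t)=\sum_{n\ge0}D^n(f)\frac{t^n}{n!}$. Then $$\mathrm{Gen}(x^{-1}y,t)=x^{-1}y\cosh\big(t\sqrt{y^2-x^2}\big)-x^{-1}\sqrt{y^2-x^2}\,\sinh\big(t\sqrt{y^2-x^2}\big).$$
   Context: With $s=\sqrt{y^2-x^2}$, $\cosh(ts)=\sum_{n\ge0}s^{2n}\frac{t^{2n}}{(2n)!}$ and $s\sinh(ts)=\sum_{n\ge0}s^{2n+2}\frac{t^{2n+1}}{(2n+1)!}$ as formal power series in $t$ whose coefficients are polynomials in $y^2-x^2$. *)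

(* Defs.v *)
From HB Require Import structures.
From mathcomp Require Import all_boot all_order all_algebra finmap.
From mathcomp.multinomials Require Import monalg.

Set Implicit Arguments.
Unset Strict Implicit.
Unset Printing Implicit Defensive.

Import GRing.Theory.
Local Open Scope fset_scope.
Local Open Scope ring_scope.

(* A Laurent polynomial in x, y over R is a finitely supported function        *)
(* int * int -> R; f@_(i, j) is the coefficient of x^i y^j. The product of     *)
(* {malg R[K]} is only available when 1 is the only invertible element of the  *)
(* monoid K, which fails for the exponent group int * int; so only the         *)
(* R-module structure is inherited and the ring structure is built below.      *)
Definition laurent (R : comNzRingType) : Type := {malg R[(int * int)%type]}.

HB.instance Definition _ (R : comNzRingType) :=
  GRing.Lmodule.copy (laurent R) {malg R[(int * int)%type]}.

(* The term c x^i y^j, for k = (i, j). Here and below, definitions are locked  *)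
(* to prevent unification from unfolding them.                                 *)
HB.lock Definition lterm (R : comNzRingType) (c : R) (k : int * int) :
  laurent R := << c *g k >>.

HB.lock Definition lmul (R : comNzRingType) (f g : laurent R) : laurent R :=
  \sum_(k1 <- msupp f) \sum_(k2 <- msupp g) lterm (f@_k1 * g@_k2) (k1 + k2).

HB.lock Definition pdx (R : comNzRingType) (f : laurent R) : laurent R :=
  \sum_(k <- msupp f) lterm (f@_k * (k.1)%:~R) (k.1 - 1, k.2).

HB.lock Definition pdy (R : comNzRingType) (f : laurent R) : laurent R :=
  \sum_(k <- msupp f) lterm (f@_k * (k.2)%:~R) (k.1, k.2 - 1).

Section LaurentRing.
Variable R : comNzRingType.
Implicit Types (c : R) (f g h : laurent R) (k : int * int).

Lemma laurentP f g : (forall i j, f@_(i, j) = g@_(i, j)) <-> f = g.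
Proof. by split=> [fg|->//]; apply/malgP => -[i j]; apply: fg. Qed.

Lemma lcoef0 k : (0 : laurent R)@_k = 0.
Proof. exact: mcoeff0. Qed.

Lemma lcoefD f g k : (f + g)@_k = f@_k + g@_k.
Proof. exact: mcoeffD. Qed.

Lemma lcoefN f k : (- f)@_k = - f@_k.
Proof. exact: mcoeffN. Qed.

Lemma lcoefZ c f k : (c *: f)@_k = c * f@_k.
Proof. exact: mcoeffZ. Qed.

Lemma lcoef_term c k k' : (lterm c k)@_k' = c *+ (k == k').
Proof. by rewrite lterm.unlock mcoeffU. Qed.

Lemma lcoef_sum (I : Type) (r : seq I) (F : I -> laurent R) k :
  (\sum_(i <- r) F i)@_k = \sum_(i <- r) (F i)@_k.
Proof. by apply: (big_morph (mcoeff k)) => [f g|]; [apply: lcoefD|apply: lcoef0]. Qed.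

Lemma lterm0 k : lterm 0 k = 0 :> laurent R.
Proof. by rewrite lterm.unlock monalgU0. Qed.

Lemma ltermD c c' k : lterm (c + c') k = lterm c k + lterm c' k.
Proof. by rewrite lterm.unlock monalgUD. Qed.

Lemma ltermZ c c' k : c *: lterm c' k = lterm (c * c') k.
Proof. by apply/malgP => k'; rewrite lcoefZ !lcoef_term mulrnAr. Qed.

Lemma msupp_term c k : msupp (lterm c k) `<=` [fset k].
Proof. by rewrite lterm.unlock; apply: msuppU_le. Qed.

Lemma laurentE f : f = \sum_(k <- msupp f) lterm f@_k k.
Proof. by rewrite lterm.unlock; apply: monalgE. Qed.

Lemma laurent_ind (P : laurent R -> Prop) :
  P 0 -> (forall f g, P f -> P g -> P (f + g)) ->
  (forall c k, P (lterm c k)) -> forall f, P f.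
Proof. by move=> P0 PD PU f; rewrite [f]laurentE; apply: big_ind. Qed.

Lemma lmulw (d1 d2 : {fset int * int}) f g :
  msupp f `<=` d1 -> msupp g `<=` d2 ->
  lmul f g = \sum_(k1 <- d1) \sum_(k2 <- d2) lterm (f@_k1 * g@_k2) (k1 + k2).
Proof.
move=> le_d1 le_d2; rewrite lmul.unlock (big_fset_incl _ le_d1) /=.
  apply/eq_bigr=> k1 _; apply/big_fset_incl => // k _ /mcoeff_outdom ->.
  by rewrite mulr0 lterm0.
move=> k _ /mcoeff_outdom g1k.
by rewrite big1 => // k' _; rewrite g1k mul0r lterm0.
Qed.

Lemma lmulC : commutative (@lmul R).
Proof.
move=> f g; rewrite lmul.unlock exchange_big; apply/eq_bigr=> k1 _.
by apply/eq_bigr=> k2 _; rewrite mulrC addrC.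
Qed.

Lemma lmulDl : left_distributive (@lmul R) +%R.
Proof.
move=> f g h.
rewrite (lmulw (fsubsetUl (msupp f) (msupp g)) (fsubset_refl (msupp h))).
rewrite (lmulw (fsubsetUr (msupp f) (msupp g)) (fsubset_refl (msupp h))).
rewrite (lmulw (msuppD_le f g) (fsubset_refl (msupp h))).
rewrite -big_split /=; apply/eq_bigr=> k1 _.
rewrite -big_split /=; apply/eq_bigr=> k2 _.
by rewrite lcoefD mulrDl ltermD.
Qed.

Lemma lmulDr : right_distributive (@lmul R) +%R.
Proof. by move=> f g h; rewrite lmulC lmulDl !(lmulC _ f). Qed.

Lemma lmul0l : left_zero 0 (@lmul R).
Proof. by move=> f; apply: (addIr (lmul 0 f)); rewrite -lmulDl !add0r. Qed.

Lemma lmul0r : right_zero 0 (@lmul R).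
Proof. by move=> f; rewrite lmulC lmul0l. Qed.

Lemma lmul_term c c' k k' :
  lmul (lterm c k) (lterm c' k') = lterm (c * c') (k + k').
Proof.
rewrite (lmulw (msupp_term c k) (msupp_term c' k')) !big_seq_fset1.
by rewrite !lcoef_term !eqxx.
Qed.

Lemma lmulA : associative (@lmul R).
Proof.
move=> f g h; elim/laurent_ind: f => [|f f' IH IH'|c k].
- by rewrite 3!lmul0l.
- by rewrite 3!lmulDl IH IH'.
elim/laurent_ind: g => [|g g' IH IH'|c' k'].
- by rewrite lmul0l lmul0r lmul0l.
- by rewrite lmulDl !lmulDr lmulDl IH IH'.
elim/laurent_ind: h => [|h h' IH IH'|c'' k''].
- by rewrite 3!lmul0r.
- by rewrite 3!lmulDr IH IH'.
by rewrite 4!lmul_term mulrA addrA.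
Qed.

Lemma lmul1l : left_id (lterm 1 0) (@lmul R).
Proof.
move=> f; elim/laurent_ind: f => [|f f' IH IH'|c k].
- by rewrite lmul0r.
- by rewrite lmulDr IH IH'.
by rewrite lmul_term mul1r add0r.
Qed.

Lemma lone_neq0 : lterm 1 0 != 0 :> laurent R.
Proof.
apply/eqP => /(congr1 (mcoeff 0))/eqP.
by rewrite lcoef_term lcoef0 eqxx oner_eq0.
Qed.

HB.instance Definition _ := GRing.Zmodule_isComNzRing.Build (laurent R)
  lmulA lmulC lmul1l lmulDl lone_neq0.

Lemma ltermM c c' k k' : lterm c k * lterm c' k' = lterm (c * c') (k + k').
Proof. exact: lmul_term. Qed.

Lemma lscaleE c f : c *: f = lterm c 0 * f.
Proof.
elim/laurent_ind: f => [|f g IH IH'|c' k]; first by rewrite scaler0 mulr0.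
  by rewrite scalerDr mulrDr IH IH'.
by rewrite ltermM add0r ltermZ.
Qed.

Lemma lscaleAl c f g : c *: (f * g) = (c *: f) * g.
Proof. by rewrite !lscaleE mulrA. Qed.

HB.instance Definition _ :=
  GRing.Lmodule_isLalgebra.Build R (laurent R) lscaleAl.
HB.instance Definition _ := GRing.Lalgebra_isComAlgebra.Build R (laurent R).

Definition lx : laurent R := lterm 1 (1, 0).
Definition ly : laurent R := lterm 1 (0, 1).
Definition lxV : laurent R := lterm 1 (-1, 0).

Lemma lx_mulV : lx * lxV = 1.
Proof. by rewrite ltermM mulr1. Qed.

Definition Dxy f : laurent R := lx * ly * pdx f + lx ^+ 2 * pdy f.

Lemma lcoef_pdx f i j : (pdx f)@_(i, j) = f@_(i + 1, j) * (i + 1)%:~R.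
Proof.
rewrite pdx.unlock [f in RHS]laurentE !lcoef_sum mulr_suml.
apply: eq_bigr => -[i' j'] _; rewrite !lcoef_term !xpair_eqE /= subr_eq.
by case: eqP => [->|_]; case: eqP => _; rewrite ?mul0r.
Qed.

Lemma lcoef_pdy f i j : (pdy f)@_(i, j) = f@_(i, j + 1) * (j + 1)%:~R.
Proof.
rewrite pdy.unlock [f in RHS]laurentE !lcoef_sum mulr_suml.
apply: eq_bigr => -[i' j'] _; rewrite !lcoef_term !xpair_eqE /= subr_eq.
by case: eqP => _; case: eqP => [->|_]; rewrite ?mul0r.
Qed.

Lemma pdx_linear : linear (@pdx R).
Proof.
move=> c f g; apply/laurentP => i j.
by rewrite lcoef_pdx !lcoefD !lcoefZ !lcoef_pdx mulrDl mulrA.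
Qed.

Lemma pdy_linear : linear (@pdy R).
Proof.
move=> c f g; apply/laurentP => i j.
by rewrite lcoef_pdy !lcoefD !lcoefZ !lcoef_pdy mulrDl mulrA.
Qed.

HB.instance Definition _ :=
  GRing.isLinear.Build R (laurent R) (laurent R) _ (@pdx R) pdx_linear.
HB.instance Definition _ :=
  GRing.isLinear.Build R (laurent R) (laurent R) _ (@pdy R) pdy_linear.

Lemma pdx_term c i j : pdx (lterm c (i, j)) = lterm (c * i%:~R) (i - 1, j).
Proof.
apply/laurentP => i' j'; rewrite lcoef_pdx !lcoef_term !xpair_eqE subr_eq.
by case: eqP => [->|_]; case: eqP => _; rewrite ?mul0r.
Qed.

Lemma pdy_term c i j : pdy (lterm c (i, j)) = lterm (c * j%:~R) (i, j - 1).
Proof.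
apply/laurentP => i' j'; rewrite lcoef_pdy !lcoef_term !xpair_eqE subr_eq.
by case: eqP => _; case: eqP => [->|_]; rewrite ?mul0r.
Qed.

Lemma leibniz_term (d : {linear laurent R -> laurent R}) :
  (forall c k c' k', d (lterm c k * lterm c' k') =
     d (lterm c k) * lterm c' k' + lterm c k * d (lterm c' k')) ->
  forall f g, d (f * g) = d f * g + f * d g.
Proof.
move=> dU f g; elim/laurent_ind: f => [|f f' IH IH'|c k].
- by rewrite !mul0r linear0 mul0r addr0.
- by rewrite mulrDl !linearD IH IH' !mulrDl addrACA.
elim/laurent_ind: g => [|g g' IH IH'|c' k'].
- by rewrite !mulr0 linear0 mulr0 addr0.
- by rewrite mulrDr !linearD IH IH' !mulrDr addrACA.
exact: dU.
Qed.

Lemma pdxM f g : pdx (f * g) = pdx f * g + f * pdx g.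
Proof.
apply: (leibniz_term (d := @pdx R)) => c [i j] c' [i' j'] /=.
have pairD (a b a' b' : int) : (a, b) + (a', b') = (a + a', b + b') by [].
rewrite !ltermM pairD !pdx_term !ltermM !pairD.
rewrite [i - 1 + i']addrAC [i + (i' - 1)]addrA.
by rewrite -ltermD intrD mulrDr mulrAC mulrA.
Qed.

Lemma pdyM f g : pdy (f * g) = pdy f * g + f * pdy g.
Proof.
apply: (leibniz_term (d := @pdy R)) => c [i j] c' [i' j'] /=.
have pairD (a b a' b' : int) : (a, b) + (a', b') = (a + a', b + b') by [].
rewrite !ltermM pairD !pdy_term !ltermM !pairD.
rewrite [j - 1 + j']addrAC [j + (j' - 1)]addrA.
by rewrite -ltermD intrD mulrDr mulrAC mulrA.
Qed.

Lemma Dxy_linear : linear Dxy.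
Proof.
move=> c f g; rewrite /Dxy pdx_linear pdy_linear.
rewrite [_ * (_ + pdx g)]mulrDr [_ * (_ + pdy g)]mulrDr -!scalerAr scalerDr.
by rewrite addrACA.
Qed.

HB.instance Definition _ :=
  GRing.isLinear.Build R (laurent R) (laurent R) _ Dxy Dxy_linear.

Lemma DxyM f g : Dxy (f * g) = Dxy f * g + f * Dxy g.
Proof.
rewrite /Dxy pdxM pdyM; move: (lx * ly) (lx ^+ 2) (pdx f) (pdx g) => a b u v.
move: (pdy f) (pdy g) => w z.
by rewrite !mulrDr mulrDl addrACA !mulrA (mulrC f a) (mulrC f b).
Qed.

Lemma Dxy_lx : Dxy lx = lx * ly.
Proof.
by rewrite /Dxy pdx_term pdy_term !mul1r lterm0 mulr0 addr0; apply: mulr1.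
Qed.

Lemma Dxy_ly : Dxy ly = lx ^+ 2.
Proof.
by rewrite /Dxy pdx_term pdy_term !mul1r lterm0 mulr0 add0r; apply: mulr1.
Qed.

End LaurentRing.

Arguments lx {R}.
Arguments ly {R}.
Arguments lxV {R}.

(* A formal power series in t over A is its coefficient sequence n |-> [t^n],  *)
(* compared by =1. The operations \*o and \- on functions give the product by  *)
(* an element of A and the difference.                                         *)
Definition fps (A : Type) : Type := nat -> A.

Section Series.
Variable K : fieldType.

Definition Gen (f : laurent K) : fps (laurent K) :=
  fun n => (n`!%:R : K)^-1 *: iter n (@Dxy K) f.

(* The next two series are even in s, hence depend only on w = s^2:            *)
(* cosh(ts) = sum_m w^m t^(2m)/(2m)!,                                          *)
(* s sinh(ts) = sum_m w^(m+1) t^(2m+1)/(2m+1)!.                                *)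
Definition cosh_sqrt (w : laurent K) : fps (laurent K) :=
  fun n => if odd n then 0 else (n`!%:R : K)^-1 *: w ^+ n./2.

Definition sqrt_sinh_sqrt (w : laurent K) : fps (laurent K) :=
  fun n => if odd n then (n`!%:R : K)^-1 *: w ^+ (n./2).+1 else 0.

End Series.

(* Main.v *)
Require Import Defs.
From HB Require Import structures.
From mathcomp Require Import all_boot all_order all_algebra finmap.
From mathcomp.multinomials Require Import monalg.

Set Implicit Arguments.
Unset Strict Implicit.
Unset Printing Implicit Defensive.

Import GRing.Theory.
Local Open Scope ring_scope.

(** The polynomial w = y^2 - x^2 is a constant of D, and D(x^-1 y) = - x^-1 w,
    D(x^-1) = - x^-1 y.  Hence D^2 acts on x^-1 y as multiplication by w. *)

(** Since D(w) = 0, powers of w pass through D ([Dxy_constM_exp]). So the even iterates of D on x^-1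
    y are x^-1 y w^m and the odd ones are - x^-1 w^(m+1) ([iter_Dxy_double], [iter_Dxy_doubleS]).
    Divided by n!, they are the coefficients of x^-1 y cosh(ts) and of - x^-1 s sinh(ts), with s^2 =
    w. *)

Section ConstantOfDerivation.
Variable R : comNzRingType.
Implicit Types f g : laurent R.

Local Notation w := (ly ^+ 2 - lx ^+ 2 : laurent R).

(** Apply D to x x^-1 = 1 by the Leibniz rule, then multiply by x^-1. *)
Lemma Dxy_lxV : Dxy lxV = - (lxV * ly) :> laurent R.
Proof.
have D1 : Dxy 1 = 0 :> laurent R.
  by apply: (addrI (Dxy 1)); rewrite addr0 -{3}[1]mulr1 DxyM mulr1 mul1r.
have xDxV : lx * Dxy lxV = - ly :> laurent R.
  have := DxyM (lx : laurent R) lxV.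
  rewrite lx_mulV D1 Dxy_lx mulrAC lx_mulV mul1r addrC.
  by move/esym/eqP; rewrite addr_eq0 => /eqP.
by rewrite -[LHS]mul1r -lx_mulV [lx * lxV]mulrC -mulrA xDxV mulrN.
Qed.

(** D(y^2) and D(x^2) are both 2 x^2 y. *)
Lemma Dxy_w : Dxy w = 0.
Proof.
rewrite linearB /= !expr2 !DxyM Dxy_lx Dxy_ly expr2.
by rewrite [ly * _]mulrC mulrA mulrAC subrr.
Qed.

Lemma Dxy_constM_exp f g n : Dxy g = 0 -> Dxy (f * g ^+ n) = Dxy f * g ^+ n.
Proof.
move=> Dg0; elim: n => [|n IHn]; first by rewrite expr0 !mulr1.
by rewrite exprSr !mulrA DxyM IHn Dg0 mulr0 addr0.
Qed.

Lemma Dxy_lxVly : Dxy (lxV * ly) = - (lxV * w).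
Proof.
by rewrite DxyM Dxy_lxV Dxy_ly mulNr -mulrA -expr2 mulrBr opprB addrC.
Qed.

Lemma Dxy_lxVw : Dxy (- (lxV * w)) = lxV * ly * w.
Proof. by rewrite linearN /= DxyM Dxy_lxV Dxy_w mulr0 addr0 mulNr opprK. Qed.

Lemma iter_Dxy_double m :
  iter m.*2 (@Dxy R) (lxV * ly) = lxV * ly * w ^+ m.
Proof.
elim: m => [|m IHm]; first by rewrite expr0 mulr1.
rewrite doubleS !iterS IHm !(Dxy_constM_exp _ _ Dxy_w).
by rewrite Dxy_lxVly Dxy_lxVw [w ^+ m.+1]exprS mulrA.
Qed.

Lemma iter_Dxy_doubleS m :
  iter m.*2.+1 (@Dxy R) (lxV * ly) = - (lxV * w ^+ m.+1).
Proof.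
rewrite iterS iter_Dxy_double (Dxy_constM_exp _ _ Dxy_w) Dxy_lxVly.
by rewrite mulNr -mulrA -exprS.
Qed.

End ConstantOfDerivation.

Theorem theorem2p6 (K : fieldType) (charK0 : [pchar K] =i pred0) :
  Gen (lxV * ly : laurent K) =1
    (lxV * ly) \*o cosh_sqrt (ly ^+ 2 - lx ^+ 2)
    \- lxV \*o sqrt_sinh_sqrt (ly ^+ 2 - lx ^+ 2).
Proof.
move=> n; rewrite /= /Gen /cosh_sqrt /sqrt_sinh_sqrt.
(* Only the series with the parity of n contributes to t^n. *)
case: ifP => n_odd.
  (* Only the iteration count is rewritten; n! stays as it is on both sides. *)
  have {2}-> : n = n./2.*2.+1 by rewrite -[LHS]odd_double_half n_odd.
  by rewrite iter_Dxy_doubleS mulr0 sub0r -scalerAr scalerN.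
have {2}-> : n = n./2.*2 by rewrite -[LHS]odd_double_half n_odd.
by rewrite iter_Dxy_double mulr0 subr0 -scalerAr.
Qed.
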